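(* Let $(X,f)$ be a dynamical system satisfying the non-uniform specification property. Let $K\subset\mathcal{M}_f(X)$ be a non-empty subset. If $G^K\neq\varnothing$, then for any non-empty open set $U\subset X$ there exists an uncountable DC1-scrambled set $S^K$ contained in $G^K\cap U\cap\mathrm{Trans}(f)$.
   Context: A dynamical system $(X,f)$ consists of a compact metric space $(X,d)$ with at least two points and a continuous map $f:X\to X$. $\mathbb{N}$ denotes the positive integers. $\mathcal{M}_f(X)$ is the space of $f$-invariant Borel probability measures on $X$, with the weak* topology. Non-uniform specification property: $(X,f)$ satisfies the non-uniform specification property with gap function $M(n,\varepsilon):\mathbb{N}\times(0,+\infty)\to\mathbb{N}$ if (i) $M(n,\varepsilon)$ is non-decreasing in $n$ and non-increasing in $\varepsilon$; (ii) for every $\varepsilon>0$, any integer $k\ge2$, any $x_1,\dots,x_k\in X$ and any non-negative integers $a_1\le b_1<a_2\le b_2<\cdots<a_k\le b_k$ with $a_{i+1}-b_i\ge M(b_i-a_i+1,\varepsilon)$ for $1\le i\le k-1$, there exists $z\in X$ such that $d(f^{n-a_i}x_i,f^nz)\le\varepsilon$ for all $a_i\le n\le b_i$ and $1\le i\le k$. $(X,f)$ satisfies the non-uniform specification property if it does so with some gap function. For $x\in X$ and $n\in\mathbb{N}$ let $\delta_x^n=\frac1n\sum_{k=0}^{n-1}\delta_{f^kx}$, where $\delta_y$ is the Dirac measure at $y$, and let $V_f(x)$ be the set of weak* accumulation points of $\{\delta_x^n\}_{n\ge1}$. For a non-empty $K\subset\mathcal{M}_f(X)$, the over-saturated set is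 $G^K=\{x\in X:V_f(x)\supset K\}$. $\mathrm{Trans}(f)=\{x\in X:\omega(x,f)=X\}$, where $\omega(x,f)$ is the $\omega$-limit set of $x$. A pair $\{x,y\}$ is DC1-scrambled if for every $t>0$, $\limsup_{n\to\infty}\frac1n|\{j\in[0,n-1]:d(f^jx,f^jy)<t\}|=1$, and there exists $t_0>0$ such that $\liminf_{n\to\infty}\frac1n|\{j\in[0,n-1]:d(f^jx,f^jy)<t_0\}|=0$ (here $j$ ranges over integers). A set $S\subset X$ is DC1-scrambled if each pair of distinct points of $S$ is DC1-scrambled. *)

(* Defs.v *)
From HB Require Import structures.
From mathcomp Require Import all_boot all_order all_algebra.
From mathcomp Require Import all_classical all_reals all_analysis.

Set Implicit Arguments.
Unset Strict Implicit.
Unset Printing Implicit Defensive.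

Import Order.TTheory GRing.Theory Num.Theory.
Import numFieldNormedType.Exports.

Local Open Scope classical_set_scope.
Local Open Scope ring_scope.

(* The base point is only there because every [measurableType] is pointed; it
   carries no information about a space that has points anyway. *)
#[short(type="pointedMetricType")]
HB.structure Definition PointedMetric (K : numDomainType) :=
  {M of Pointed M & Metric K M}.

Notation borel X := (g_sigma_algebraType (@open X)).

Section dynamics.
Context {R : realType} {X : pointedMetricType R}.
Implicit Types (f : X -> X) (x y z : X) (mu : probability (borel X) R).

Definition dynamical_system f :=
  [/\ compact [set: X], exists x y, x <> y & continuous f].

(* Only positive lengths and radii are constrained: the other values of [M] are
   never used. *)
Definition gap_function (M : nat -> R -> nat) :=
  [/\ forall n (e : R), (0 < n)%N -> 0 < e -> (0 < M n e)%N,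
      forall m n (e : R), (0 < m)%N -> (m <= n)%N -> 0 < e ->
        (M m e <= M n e)%N &
      forall n (e1 e2 : R), (0 < n)%N -> 0 < e1 -> e1 <= e2 ->
        (M n e2 <= M n e1)%N].

(* The k orbit segments are indexed by i < k; the values of [x], [a] and [b] at
   other indices are irrelevant. *)
Definition nonuniform_specification_with f (M : nat -> R -> nat) :=
  gap_function M /\
  forall e : R, 0 < e ->
  forall (k : nat) (x : nat -> X) (a b : nat -> nat), (2 <= k)%N ->
    (forall i, (i < k)%N -> (a i <= b i)%N) ->
    (forall i, (i.+1 < k)%N -> (b i < a i.+1)%N) ->
    (forall i, (i.+1 < k)%N -> (M (b i - a i + 1) e <= a i.+1 - b i)%N) ->
  exists z, forall i n, (i < k)%N -> (a i <= n <= b i)%N ->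
    mdist (iter (n - a i) f (x i)) (iter n f z) <= e.

Definition nonuniform_specification f :=
  exists M, nonuniform_specification_with f M.

Definition invariant_measures f : set (probability (borel X) R) :=
  [set mu | forall A : set (borel X), measurable A -> mu (f @^-1` A) = mu A].

(* Weak* topology: the coarsest topology for which mu |-> \int phi dmu is
   continuous for every continuous phi : X -> R. *)
Definition integral_functional mu :
    prod_topology (fun _ : continuousType X R => R) :=
  fun phi => (\int[mu]_(t in [set: borel X]) (phi t))%R.

Definition weak_star : topologicalType :=
  initial_topology integral_functional.

(* Indexed so that [empirical f x n] is the average over the first n.+1 points
   of the orbit, which is defined for all n. *)
Definition empirical f x (n : nat) : set (borel X) -> \bar R :=
  mscale (n.+1%:R^-1)%:nng
    (msum (fun k => \d_(iter k f x : borel X)) n.+1).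

HB.instance Definition _ f x n := Measure.on (empirical f x n).

Lemma empirical_setT f x n : empirical f x n [set: borel X] = 1%E.
Proof.
rewrite /empirical /mscale /= /msum (eq_bigr (fun=> 1%E)) => [|k _]; last first.
  by rewrite /= diracT.
rewrite sumEFin -EFinM sumr_const card_ord.
by rewrite mulVf// pnatr_eq0.
Qed.

HB.instance Definition _ f x n :=
  Measure_isProbability.Build _ _ _ (empirical f x n) (empirical_setT f x n).

Definition empirical_sequence f x (n : nat) : weak_star := empirical f x n.

Definition limit_measures f x : set (probability (borel X) R) :=
  cluster (empirical_sequence f x @ \oo).

Definition over_saturated f (K : set (probability (borel X) R)) : set X :=
  [set x | K `<=` limit_measures f x].

Definition omega_limit f x : set X := cluster ((fun n => iter n f x) @ \oo).

Definition transitive_points f : set X :=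
  [set x | omega_limit f x = [set: X]].

Definition close_frequency f x y (t : R) (n : nat) : R :=
  #|[set j : 'I_n | mdist (iter j f x) (iter j f y) < t]%SET|%:R / n%:R.

Definition DC1_pair f x y :=
  (forall t : R, 0 < t -> limn_sup (close_frequency f x y t) = 1) /\
  (exists2 t0 : R, 0 < t0 & limn_inf (close_frequency f x y t0) = 0).

Definition DC1_scrambled f (S : set X) :=
  forall x y, S x -> S y -> x <> y -> DC1_pair f x y.

End dynamics.

(* Main.v *)
(* Shadowing one orbit segment after another with errors [r / 2 ^ k] yields a point
   that follows prescribed segments on windows [s k, s k + L k] whose position does
   not depend on the segments, and whose length may be chosen large compared with
   [s k]. Statistics at the end of a window are then those of the followed segment.
   Running infinitely often along a fixed point x0 of G^K makes every measure of K
   an accumulation point, and makes any two of the constructed points close with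
   upper frequency 1; running along one of two orbits that stay [t] apart, according
   to a bit that is read infinitely often, separates points built from different bit
   sequences; visits to finite nets give a dense forward orbit. Two orbits staying
   apart exist because specification lets one orbit return close to x, and another
   close to y <> x, at all multiples of the same time. As K may be infinite, the
   windows along x0 must be long enough to capture all accumulation points at once:
   up to a small error, the means along an orbit depend only on rounded frequencies
   of visits to the cells of a finite partition, which take finitely many values. *)
Require Import Defs.
From mathcomp Require Import all_boot all_order all_algebra.
From mathcomp Require Import all_classical all_reals all_analysis.
From mathcomp Require Import measurable_realfun ring lra zify.

Set Implicit Arguments.
Unset Strict Implicit.
Unset Printing Implicit Defensive.

Import Order.TTheory GRing.Theory Num.Theory.
Import numFieldNormedType.Exports.

Local Open Scope classical_set_scope.
Local Open Scope ring_scope.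

(** * Uniform continuity and finite nets on a compact metric space *)

Section compact_metric.
Context {R : realType} {X : pointedMetricType R}.
Hypothesis X_compact : compact [set: X].

Lemma compact_unif_continuous (V : pseudoMetricType R) (g : X -> V) :
  continuous g -> forall e : R, 0 < e ->
  exists2 d : R, 0 < d & forall x y, mdist x y < d -> ball (g x) e (g y).
Proof.
move=> g_cont e e_gt0.
pose P (d : R) (x : X) := forall y, mdist x y < d -> ball (g x) e (g y).
suff : \forall d \near 0^'+, [set: X] `<=` P d.
  move=> near_d.
  have [|d [d_gt0 Pd]] := @filter_ex _ (0^'+ : set_system R) _
    [set d | 0 < d /\ [set: X] `<=` P d].
    by apply: filterI => //; exact: nbhs_right_gt.
  by exists d => // x y; exact: Pd.
move/compact_near_coveringP : X_compact; apply => x _.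
have : nbhs x (g @^-1` ball (g x) (e / 2)).
  by apply: g_cont; apply: nbhsx_ballx; rewrite divr_gt0.
rewrite -nbhs_ballE => -[d /= d_gt0 dP].
exists (ball x (d / 2), [set c | c < d / 2]).
  split; first by apply: nbhsx_ballx; rewrite divr_gt0.
  by apply: nbhs_right_lt; rewrite divr_gt0.
move=> [x' c] /= [xx' cd] y x'y.
rewrite [e]splitr; apply: (@ball_triangle _ _ (g x)).
  apply/ball_sym/dP; apply: le_ball xx'.
  by rewrite ler_pdivrMr// ler_pMr// ler1n.
apply: dP; rewrite [d]splitr; apply: ball_triangle xx' _.
by rewrite ballEmdist/=; exact: lt_trans x'y cd.
Qed.

Lemma finite_net (e : R) : 0 < e ->
  exists s : seq X, forall x, exists2 y, y \in s & mdist x y < e.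
Proof.
move=> e_gt0; have := X_compact; rewrite compact_cover.
move=> /(_ _ [set: X] (fun y => (ball y e)°)) [|x _|D _ cov].
- by move=> y _; exact: open_interior.
- by exists x => //; exact: nbhsx_ballx.
- exists (finmap.enum_fset D) => x; have [//|y yD /interior_subset] := cov x.
  by move=> /ball_sym; rewrite ballEmdist; exists y.
Qed.

End compact_metric.

(** * Separated orbits and gluing of orbit segments *)

Section gluing.
Context {R : realType} {X : pointedMetricType R} (f : X -> X).
Implicit Types x y z w : X.

Lemma iter_continuous n : continuous f -> continuous (iter n f).
Proof.
move=> f_cont; elim: n => [|n IH] x; first exact: cvg_id.
exact: continuous_comp (IH x) (f_cont _).
Qed.

(** Carries shadowing estimates from approximate points to a cluster point, without extracting a
    convergent subsequence. *)
Lemma cluster_mdist_le (u : nat -> X) z (g : X -> X) w (c : R) :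
  cluster (u @ \oo) z -> continuous g ->
  (\forall n \near \oo, mdist w (g (u n)) <= c) -> mdist w (g z) <= c.
Proof.
move=> uz g_cont wu; apply/ler_addgt0Pr => e e_gt0.
have gz_nbhs : nbhs z (g @^-1` ball (g z) e).
  by apply: g_cont; exact: nbhsx_ballx.
have [y [/= wy]] := uz [set y | mdist w (g y) <= c] _ wu gz_nbhs.
rewrite ballEmdist/= metric_sym => zy.
by apply: (le_trans (metric_triangle _ (g y) _)); rewrite lerD// ltW.
Qed.

Variable M : nat -> R -> nat.
Hypothesis fM : nonuniform_specification_with f M.

(** The gap is dictated by the length [T.+1] of the first segment alone, so [n] is free and may be
    chosen in terms of the starting time [T + g]. *)
Lemma specification_append (e : R) T g z w n : 0 < e -> (M T.+1 e <= g)%N ->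
  exists z', (forall i, (i <= T)%N -> mdist (iter i f z) (iter i f z') <= e) /\
    (forall i, (i <= n)%N -> mdist (iter i f w) (iter (T + g + i) f z') <= e).
Proof.
move=> e_gt0 Mg; have [[M_gt0 _ _] spec] := fM.
have g_gt0 : (0 < g)%N by rewrite (leq_trans _ Mg)// M_gt0.
have [||||z' z'P] := spec e e_gt0 2%N (fun i => if i == 0%N then z else w)
  (fun i => if i == 0%N then 0%N else (T + g)%N)
  (fun i => if i == 0%N then T else (T + g + n)%N).
- by [].
- by case=> [|i] //= _; rewrite leq_addr.
- by case=> [|i] //= _; rewrite -[X in (X < _)%N]addn0 ltn_add2l.
- by case=> [|i] //= _; rewrite subn0 addn1 addKn.
exists z'; split=> i iT.
  by have := z'P 0%N i isT; rewrite subn0; apply.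
have := z'P 1%N (T + g + i)%N isT; rewrite addKn; apply.
by rewrite leq_addr leq_add2l.
Qed.

(** At multiples of [P] one orbit is within [d / 4] of [x], the other within [d / 4] of [y], so they
    are at least [d / 2] apart there. Coming closer than [t] would, by uniform continuity of the
    iterates up to [P], force a distance below [d / 2] at the next multiple. *)
Lemma separated_orbits : dynamical_system f ->
  exists2 t : R, 0 < t & forall N, exists p q, forall n, (n <= N)%N ->
    t <= mdist (iter n f p) (iter n f q).
Proof.
move=> [X_compact [x [y /eqP xy]] f_cont]; have [[M_gt0 _ _] spec] := fM.
pose d := mdist x y; have d_gt0 : 0 < d by rewrite mdist_gt0.
have d4_gt0 : 0 < d / 4 by rewrite divr_gt0.
pose P := M 1 (d / 4); have P_gt0 : (0 < P)%N by exact: M_gt0.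
have [t t_gt0 tP] : exists2 t : R, 0 < t & forall i u v, (i <= P)%N ->
    mdist u v < t -> mdist (iter i f u) (iter i f v) < d / 2.
  elim: P {P_gt0} => [|P [t t_gt0 tP]].
    by exists (d / 2) => [|[]//]; rewrite divr_gt0.
  have d2_gt0 : 0 < d / 2 by rewrite divr_gt0.
  have [t' t'_gt0 t'P] := compact_unif_continuous X_compact
    (@iter_continuous P.+1 f_cont) d2_gt0.
  exists (Num.min t t') => [|i u v]; first by rewrite lt_min t_gt0.
  rewrite lt_min leq_eqVlt ltnS => /orP[/eqP-> /andP[_ /t'P]|iP /andP[uv _]].
    by rewrite ballEmdist.
  exact: tP.
(* Segments consisting of one point need only the gap [M 1 (d / 4)]. Taking [N.+2] of them ensures
   that there are at least two. *)
have orbit_near w N : exists z, forall j, (j <= N)%N ->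
    mdist w (iter (j * P) f z) <= d / 4.
  have [||||z zP] := spec _ d4_gt0 N.+2 (fun=> w) (fun i => i * P)%N
    (fun i => i * P)%N.
  - by [].
  - by [].
  - by move=> i _; rewrite ltn_mul2r P_gt0/=.
  - by move=> i _; rewrite subnn add0n -mulnBl subSnn mul1n.
  exists z => j jN; have := zP j (j * P)%N; rewrite subnn leqnn.
  by apply=> //; rewrite ltnS ltnW.
exists t => // N; have [p pP] := orbit_near x N.+1.
have [q qP] := orbit_near y N.+1.
exists p, q => n nN; rewrite leNgt; apply/negP => pq_lt.
pose j := (n %/ P).+1.
have nj : (n <= j * P)%N by rewrite ltnW// ltn_ceil.
have jN : (j <= N.+1)%N by rewrite ltnS (leq_trans (leq_div _ _)).
have jnP : (j * P - n <= P)%N.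
  by rewrite leq_subLR mulSn addnC leq_add2r leq_divM.
have := tP _ _ _ jnP pq_lt; rewrite -!iterD subnK//.
have := metric_triangle x (iter (j * P) f p) y.
have := metric_triangle (iter (j * P) f p) (iter (j * P) f q) y.
have := pP j jN; have := qP j jN; rewrite (metric_sym y) -/d; lra.
Qed.

(* Everything built so far is re-shadowed as a single orbit segment, so that the
   specification property is only ever used for two segments and the errors
   [r / 2 ^ k.+1] add up to at most [r]. The times [s k] depend only on the
   lengths [L], not on the points [w k] that are followed. *)
Lemma specification_gluing (L : nat -> nat -> nat) (u : X) (r : R) :
  compact [set: X] -> continuous f -> 0 < r ->
  exists2 s : nat -> nat,
    (0 < s 0)%N /\ forall k, (s k + L k (s k) < s k.+1)%N &
    forall w : nat -> X, exists2 z, mdist u z <= r &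
      forall k i, (i <= L k (s k))%N ->
        mdist (iter i f (w k)) (iter (s k + i) f z) <= r / 2 ^+ k.
Proof.
move=> X_compact f_cont r_gt0; have [[M_gt0 _ _] _] := fM.
pose e k : R := r / 2 ^+ k.+1.
have e_gt0 k : 0 < e k by rewrite divr_gt0// exprn_gt0.
(* [T k] is the last time controlled before stage [k]; the window of stage [k] starts at [s k], one
   gap later. *)
pose T := fix T k := if k is k'.+1 then
  let s := (T k' + M (T k').+1 (e k'))%N in (s + L k' s)%N else 0%N.
pose s k := (T k + M (T k).+1 (e k))%N.
have TS k : T k.+1 = (s k + L k (s k))%N by [].
have Ts k : (T k < s k)%N by rewrite -[X in (X < _)%N]addn0 ltn_add2l M_gt0.
exists s => [|w].
  by split=> [|k]; [exact: leq_ltn_trans (Ts 0%N)|rewrite -TS].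
have /choice[step stepP] : forall kz : nat * X, exists z',
    (forall i, (i <= T kz.1)%N ->
      mdist (iter i f kz.2) (iter i f z') <= e kz.1) /\
    (forall i, (i <= L kz.1 (s kz.1))%N ->
      mdist (iter i f (w kz.1)) (iter (s kz.1 + i) f z') <= e kz.1).
  by move=> [k z]; exact: specification_append.
pose z := fix z k := if k is k'.+1 then step (k', z k') else u.
(* The error allowed from stage [k] on pays for this stage and for all later ones; this drives the
   inductions below. *)
have e_tail k : e k + r / 2 ^+ k.+1 = r / 2 ^+ k.
  by rewrite /e exprS; field; rewrite expf_neq0.
have T_mono : {homo T : m n / (m <= n)%N}.
  apply: homo_leq => // [? ? ?|k]; first exact: leq_trans.
  by rewrite TS ltnW// ltn_addr.
have z_mdist k m i : (i <= T k)%N ->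
    mdist (iter i f (z k)) (iter i f (z (k + m)%N)) <= r / 2 ^+ k.
  elim: m k => [|m IH] k iT; first by rewrite addn0 mdistxx divr_ge0// ltW.
  rewrite addnS -addSn -e_tail (le_trans (metric_triangle _ (iter i f (z k.+1)) _))//.
  by rewrite lerD ?IH ?(stepP (k, z k)).1 ?(leq_trans iT) ?T_mono.
have w_mdist k m i : (i <= L k (s k))%N ->
    mdist (iter i f (w k)) (iter (s k + i) f (z (k.+1 + m)%N)) <= r / 2 ^+ k.
  move=> iL; rewrite -e_tail.
  rewrite (le_trans (metric_triangle _ (iter (s k + i) f (z k.+1)) _))// lerD//.
    exact: (stepP (k, z k)).2.
  by apply: z_mdist; rewrite TS leq_add2l.
have [y [_ zy]] : exists y, [set: X] y /\ cluster (z @ \oo) y.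
  by have [y] := X_compact (z @ \oo) _ filterT; exists y.
exists y => [|k i iL].
  apply: (cluster_mdist_le (g := id)) zy _ _; first by move=> ?; exact: cvg_id.
  by apply: nearW => n; have := @z_mdist 0%N n 0%N (leqnn _); rewrite expr0 divr1.
apply: cluster_mdist_le zy _ _; first exact: iter_continuous.
near=> n; have -> : n = (k.+1 + (n - k.+1))%N.
  by rewrite subnKC//; near: n; exact: nbhs_infty_ge.
exact: w_mdist.
Unshelve. all: by end_near. Qed.

End gluing.

(** * Means along an orbit: delays and recurrence *)

Section means.
Context {R : realType}.

Definition mean (u : nat -> R) (n : nat) : R := (\sum_(i < n) u i) / n%:R.

Lemma mean_shift (a b : nat -> R) s m (B eta : R) : (0 < m)%N ->
  (forall i, `|a i| <= B) -> (forall i, `|b i| <= B) ->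
  (forall i, (i < m)%N -> `|b i - a (s + i)%N| <= eta) ->
  `|mean b m - mean a (s + m)| <= eta + 2 * B * (s%:R / (s + m)%:R).
Proof.
move=> m_gt0 aB bB abE.
have m_gt0' : 0 < m%:R :> R by rewrite ltr0n.
have sm_gt0 : 0 < (s + m)%:R :> R by rewrite ltr0n addn_gt0 m_gt0 orbT.
have B_ge0 : 0 <= B by exact: le_trans (aB 0%N).
have sum_le n (u : nat -> R) c : (forall i, (i < n)%N -> `|u i| <= c) ->
    `|\sum_(i < n) u i| <= n%:R * c.
  move=> uc; rewrite (le_trans (ler_norm_sum _ _ _))//.
  apply: (@le_trans _ _ (\sum_(i < n) c)); first by apply: ler_sum => i _; exact: uc.
  by rewrite sumr_const card_ord mulr_natl.
rewrite /mean big_split_ord/=.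
set A := \sum_(i < m) b i; set A1 := \sum_(i < s) _; set A2 := \sum_(i < m) _.
have A_le : `|A| <= m%:R * B by exact: sum_le.
have A1_le : `|A1| <= s%:R * B by exact: sum_le.
have A2_le : `|A - A2| <= m%:R * eta.
  by rewrite -sumrB; apply: (sum_le _ (fun i => b i - a (s + i)%N)).
have eta_ge0 : 0 <= eta by exact: le_trans (abE 0%N m_gt0).
(* The first term is the error inside the window. The second collects the initial [s] terms and the
   change of denominator, each costing at most [B * s / (s + m)]. *)
have -> : A / m%:R - (A1 + A2) / (s + m)%:R =
    (A - A2) / (s + m)%:R + (A * (s%:R / m%:R) - A1) / (s + m)%:R.
  by rewrite natrD; field; rewrite -natrD !gt_eqF.
apply: (le_trans (ler_normD _ _)); rewrite !normrM !normfV !(gtr0_norm sm_gt0).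
apply: lerD.
  rewrite ler_pdivrMr// (le_trans A2_le)// mulrC ler_wpM2l//.
  by rewrite ler_nat leq_addl.
rewrite [leRHS]mulrA ler_pM2r ?invr_gt0//.
apply: (le_trans (ler_normB _ _)); rewrite normrM [X in _ * X]ger0_norm; last first.
  by rewrite divr_ge0.
have -> : 2 * B * s%:R = m%:R * B * (s%:R / m%:R) + s%:R * B by field; rewrite gt_eqF.
by apply: lerD => //; apply: ler_wpM2r => //; rewrite divr_ge0.
Qed.

(** Pick one index past [lo] for each value attained there; [N] bounds these finitely many
    indices. *)
Lemma finite_recurrence (T : finType) (v : nat -> T) lo :
  exists2 N, (lo <= N)%N & forall n, (lo <= n)%N ->
    exists2 n', (lo <= n' <= N)%N & v n' = v n.
Proof.
have /choice[m mP] : forall t, exists m, (exists2 n, (lo <= n)%N & v n = t) ->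
    (lo <= m)%N /\ v m = t.
  move=> t; have [[n lon vn]|noN] := pselect (exists2 n, (lo <= n)%N & v n = t).
    by exists n.
  by exists 0%N.
exists (maxn lo (\max_t m t)) => [|n lon]; first exact: leq_maxl.
have [|lom mE] := mP (v n); first by exists n.
by exists (m (v n)) => //; rewrite lom leq_max leq_bigmax orbT.
Qed.

(* The frequencies with which [x] visits the cells of a finite partition into
   sets of small diameter, rounded to multiples of [1 / Q], only take finitely many
   values, and they determine all means up to a small error. *)
Lemma mean_recurrence (X : pointedMetricType R) (x : nat -> X) (e : R) lo :
  compact [set: X] -> 0 < e ->
  exists2 N, (lo <= N)%N & forall n, (lo <= n)%N ->
    exists2 n', (lo <= n' <= N)%N &
    forall (phi : X -> R) (B eta : R), (forall y, `|phi y| <= B) ->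
      (forall y z, mdist y z < e -> `|phi y - phi z| <= eta) ->
      `|mean (phi \o x) n'.+1 - mean (phi \o x) n.+1| <= 2 * eta + e * B.
Proof.
move=> X_compact e_gt0; have [c cP] := finite_net X_compact e_gt0.
pose m := size c; pose d (j : 'I_m) := nth point c j.
have /choice[cell cellP] : forall y, exists j : 'I_m, mdist y (d j) < e.
  move=> y; have [z zc yz] := cP y; have zm : (index z c < m)%N by rewrite index_mem.
  by exists (Ordinal zm); rewrite /d /= nth_index.
(* Rounding costs at most [B / Q.+1] per cell, hence at most [e * B] over all [m] cells. *)
have [Q mQ] : exists Q, m%:R / e < Q.+1%:R.
  exists (Num.bound (m%:R / e)); apply: (@lt_trans _ _ (Num.bound (m%:R / e))%:R).
    by rewrite archi_boundP// divr_ge0// ltW.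
  by rewrite ltr_nat.
pose count n j := (\sum_(i < n.+1) (cell (x i) == j))%N.
have count_le n j : (count n j <= n.+1)%N.
  rewrite (leq_trans (leq_sum _ (fun i _ => leq_b1 _)))//.
  by rewrite sum1_card card_ord.
pose freq n j : R := (count n j)%:R / n.+1%:R.
(* A frequency may equal 1, so the rounded values run from 0 to [Q.+1] inclusive. *)
pose v n := [ffun j => inord ((Q.+1 * count n j) %/ n.+1)%N : 'I_Q.+2].
have [N loN NP] := finite_recurrence v lo.
exists N => // n lon; have [n' n'N vE] := NP n lon; exists n' => //.
move=> phi B eta phiB phi_eta.
have B_ge0 : 0 <= B by exact: le_trans (phiB point).
have freq_bounds k j : (v k j)%:R <= Q.+1%:R * freq k j <= (v k j).+1%:R.
  rewrite /freq !mulrA -natrM ler_pdivlMr ?ltr0n// ler_pdivrMr ?ltr0n//.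
  have vE' : v k j = ((Q.+1 * count k j) %/ k.+1)%N :> nat.
    rewrite ffunE inordK// ltnS -[X in (_ <= X)%N](mulnK Q.+1 (ltn0Sn k)).
    by rewrite leq_div2r// leq_mul2l count_le orbT.
  by rewrite vE' -!natrM !ler_nat leq_divM/= ltnW// ltn_ceil.
have freq_near j : `|freq n' j - freq n j| <= Q.+1%:R^-1 :> R.
  have := freq_bounds n' j; have := freq_bounds n j; rewrite vE => b b'.
  rewrite -(ler_pM2l (ltr0Sn _ Q)) divff ?pnatr_eq0//.
  rewrite -[X in X * `|_|](@ger0_norm _ Q.+1%:R)// -normrM mulrBr ler_norml.
  move: b b'; rewrite -natr1; lra.
(* Moving each orbit point to the centre of its cell costs [eta]; this is done for both means,
   whence [2 * eta]. *)
have mean_cells k : `|mean (phi \o x) k.+1 -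
    \sum_j phi (d j) * freq k j| <= eta.
  have -> : \sum_j phi (d j) * freq k j =
      (\sum_(i < k.+1) phi (d (cell (x i)))) / k.+1%:R.
    rewrite /freq; under eq_bigr do rewrite mulrA.
    rewrite -!mulr_suml; congr (_ / _).
    under eq_bigr do rewrite natr_sum mulr_sumr.
    rewrite exchange_big/=; apply: eq_bigr => i _.
    rewrite (bigD1 (cell (x i)))//= eqxx mulr1 big1 ?addr0// => j /negbTE ji.
    by rewrite eq_sym ji mulr0.
  rewrite /mean -mulrBl -sumrB normrM normfV [`|k.+1%:R|]ger0_norm//.
  rewrite ler_pdivrMr ?ltr0n// (le_trans (ler_norm_sum _ _ _))//.
  apply: (@le_trans _ _ (\sum_(i < k.+1) eta));
    last by rewrite sumr_const card_ord mulr_natr.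
  by apply: ler_sum => i _; exact: phi_eta.
have cells_near : `|\sum_j phi (d j) * freq n' j -
    \sum_j phi (d j) * freq n j| <= e * B.
  rewrite -sumrB (le_trans (ler_norm_sum _ _ _))//.
  apply: (@le_trans _ _ (\sum_(j < m) B / Q.+1%:R)).
    apply: ler_sum => j _; rewrite -mulrBr normrM ler_pM//.
  rewrite sumr_const card_ord -[_ *+ m]mulr_natl mulrCA [e * B]mulrC.
  apply: ler_wpM2l => //.
  by rewrite ler_pdivrMr ?ltr0n// -ler_pdivrMl// mulrC ltW.
have := mean_cells n; have := mean_cells n'; move: cells_near.
by rewrite !ler_norml; lra.
Qed.

End means.

(** * Weak* accumulation points of empirical measures *)

Section weak_star_limits.

Lemma initial_cvg (S : choiceType) (T : topologicalType) (g : S -> T)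
    (F : set_system S) (s : S) : Filter F ->
  g @ F --> g s -> F --> (s : initial_topology g).
Proof.
move=> FF gFs A; rewrite nbhsE => -[B [[C oC <-] Cgs] CA].
by apply: filterS CA _; apply: gFs; exact: open_nbhs_nbhs.
Qed.

Context {R : realType} {X : pointedMetricType R} (f : X -> X).

Lemma weak_star_cvg (T : Type) (F : set_system T)
    (m : T -> probability (borel X) R) (mu : probability (borel X) R) : Filter F ->
  (forall phi : continuousType X R,
    integral_functional (m t) phi @[t --> F] --> integral_functional mu phi) ->
  (m : T -> weak_star) @ F --> (mu : weak_star).
Proof.
move=> FF m_mu; apply: initial_cvg; apply/cvg_sup => phi.
by apply: initial_cvg; exact: m_mu.
Qed.

Lemma integral_empirical x n (phi : continuousType X R) :
  integral_functional (empirical f x n) phi =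
  mean (fun i => phi (iter i f x)) n.+1.
Proof.
have phi_meas : measurable_fun [set: borel X] phi.
  apply: (measurability _ (RGenOInfty.measurableE R)) => //.
  move=> /= _ [_ [a ->] <-]; rewrite setTI; apply: sub_sigma_algebra.
  apply: open_comp => [y _|]; first exact: cts_fun.
  exact: interval_open.
have empirical_ge0 (g : borel X -> \bar R) : measurable_fun [set: borel X] g ->
    (forall y, 0 <= g y)%E ->
    (\int[empirical f x n]_(y in [set: borel X]) g y =
      (n.+1%:R^-1)%:E * \sum_(i < n.+1) g (iter i f x))%E.
  move=> g_meas g_ge0; rewrite ge0_integral_mscale// ge0_integral_measure_sum//.
  by congr (_ * _)%E; apply: eq_bigr => i _; rewrite integral_dirac// diracT mul1e.
have phi_meas' := (measurable_EFinP _ _).2 phi_meas.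
rewrite /integral_functional /Rintegral integralE.
have -> : (\int[empirical f x n]_(y in [set: borel X]) (EFin \o phi)^\+ y)%E =
    (n.+1%:R^-1 * \sum_(i < n.+1) Num.max (phi (iter i f x)) 0)%:E.
  rewrite empirical_ge0 ?EFinM -?sumEFin//; last exact: measurable_funepos.
  by congr (_ * _)%E; apply: eq_bigr => i _; rewrite funeposE/= EFin_max.
have -> : (\int[empirical f x n]_(y in [set: borel X]) (EFin \o phi)^\- y)%E =
    (n.+1%:R^-1 * \sum_(i < n.+1) Num.max (- phi (iter i f x)) 0)%:E.
  rewrite empirical_ge0 ?EFinM -?sumEFin//; last exact: measurable_funeneg.
  by congr (_ * _)%E; apply: eq_bigr => i _; rewrite funenegE/= EFin_max.
rewrite -EFinB/= -mulrBr mulrC -sumrB; congr (_ / _).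
apply: eq_bigr => i _; rewrite !maxEle; case: ifPn; case: ifPn; lra.
Qed.

(** A single time change [h] transfers all limit measures at once. For a given [mu], a filter finer
    than [\oo] along which the empirical measures of [x] converge to [mu] takes the place of a
    subsequence. *)
Lemma limit_measures_sub x z (h : nat -> nat) : h n @[n --> \oo] --> \oo ->
  (forall phi : continuousType X R,
    mean (fun i => phi (iter i f z)) (h n).+1 -
    mean (fun i => phi (iter i f x)) n.+1 @[n --> \oo] --> 0) ->
  limit_measures f x `<=` limit_measures f z.
Proof.
move=> h_oo hP mu mu_x.
pose D := [set AN : set weak_star * nat | nbhs (mu : weak_star) AN.1].
pose B (AN : set weak_star * nat) :=
  [set n | (AN.2 <= n)%N /\ AN.1 (empirical_sequence f x n)].
pose G := filter_from D B.
have G_proper : ProperFilter G.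
  apply: filter_from_proper; last first.
    move=> [A N] /= DAN.
    have [|_ [[n Nn <-] An]] := mu_x
      [set empirical_sequence f x n | n in [set n | (N <= n)%N]] A _ DAN.
      by apply: filterS (nbhs_infty_ge N) => n Nn; exists n.
    by exists n.
  apply: filter_from_filter; first by exists (setT, 0%N); exact: filterT.
  move=> [A1 N1] [A2 N2] D1 D2.
  exists (A1 `&` A2, maxn N1 N2); first exact: (filterI D1 D2).
  by move=> n [/=]; rewrite geq_max => /andP[N1n N2n] [A1n A2n].
have oo_G : G --> \oo.
  move=> A [N _ NP]; exists (setT, N); first exact: filterT.
  by move=> n [/= Nn _]; exact: NP.
have x_mu : empirical_sequence f x @ G --> (mu : weak_star).
  by move=> A Amu; exists (A, 0%N) => // n [].
have z_mu : (fun n => empirical_sequence f z (h n)) @ G --> (mu : weak_star).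
  apply: (@weak_star_cvg _ G (fun n => empirical f z (h n))) => phi.
  have x_phi : integral_functional (empirical f x n) phi @[n --> G] -->
      integral_functional mu phi.
    apply: (cvg_comp (empirical_sequence f x) (fun m => integral_functional m phi)) x_mu _.
    apply: (cvg_comp (integral_functional : weak_star -> _) (fun g => g phi)).
      exact: initial_continuous.
    exact: (@proj_continuous (continuousType X R) (fun=> R : topologicalType) phi
      (integral_functional mu)).
  under eq_fun do rewrite integral_empirical.
  rewrite -[_ mu phi]add0r.
  under eq_fun => n do
    rewrite -[mean _ (h n).+1](subrK (mean (fun i => phi (iter i f x)) n.+1)).
  apply: cvgD; first exact: cvg_trans (cvg_app _ oo_G) (hP phi).
  by under eq_fun do rewrite -integral_empirical.
move=> A C zA muC.
have [n [An Cn]] := @filter_ex _ G _ _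
  (@filterI _ G _ _ _ (oo_G _ (h_oo _ zA)) (z_mu _ muC)).
by exists (empirical_sequence f z (h n)).
Qed.

End weak_star_limits.

(** * Upper and lower frequencies of closeness *)

Section frequencies.
Context {R : realType}.

Lemma limn_sup_eq1 (u : nat -> R) : (forall n, u n <= 1) ->
  (forall (e : R) N, 0 < e -> exists2 n, (N <= n)%N & 1 - e <= u n) ->
  limn_sup u = 1.
Proof.
move=> u_le1 u_ge; suff -> : limn_sup u = limn (fun=> 1 : R) by exact: lim_cst.
(* The sequence of tail suprema is constantly 1. *)
congr (limn _); apply/funext => N /=; apply/eqP; rewrite eq_le; apply/andP; split.
  by apply: ge_sup => [|_ [n _ <-]//]; exists (u N), N => /=.
apply/ler_addgt0Pr => e /(u_ge e N)[n Nn]; rewrite lerBlDr => /le_trans; apply.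
by rewrite lerD2r ub_le_sup//; [exists 1 => _ [? _ <-]|exists n].
Qed.

Lemma limn_inf_eq0 (u : nat -> R) : (forall n, 0 <= u n) ->
  (forall (e : R) N, 0 < e -> exists2 n, (N <= n)%N & u n <= e) ->
  limn_inf u = 0.
Proof.
move=> u_ge0 u_le; suff -> : limn_inf u = limn (fun=> 0 : R) by exact: lim_cst.
congr (limn _); apply/funext => N /=; apply/eqP; rewrite eq_le; apply/andP; split.
  apply/ler_addgt0Pr => e /(u_le e N)[n Nn]; rewrite add0r; apply: le_trans.
  by rewrite ge_inf//; [exists 0 => _ [? _ <-]|exists n].
by apply: lb_le_inf => [|_ [n _ <-]//]; exists (u N), N => /=.
Qed.

Context {X : pointedMetricType R} (f : X -> X) (x y : X).

Lemma close_frequency_ge0 t n : 0 <= close_frequency f x y t n.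
Proof. by rewrite divr_ge0. Qed.

Lemma close_frequency_le1 t n : close_frequency f x y t n <= 1.
Proof.
case: n => [|n]; first by rewrite /close_frequency invr0 mulr0.
by rewrite ler_pdivrMr ?ltr0n// mul1r ler_nat (leq_trans (max_card _))// card_ord.
Qed.

Lemma close_frequency_window_ge t s m : (0 < s)%N ->
  (forall i, (i < m)%N -> mdist (iter (s + i) f x) (iter (s + i) f y) < t) ->
  m%:R / (s + m)%:R <= close_frequency f x y t (s + m).
Proof.
move=> s_gt0 close; rewrite ler_pM2r ?invr_gt0 ?ltr0n ?addn_gt0 ?s_gt0// ler_nat.
rewrite -[leqLHS](card_ord m) -(card_imset predT (@rshift_inj s m)).
by apply/subset_leq_card/fintype.subsetP => _ /imsetP[i _ ->]; rewrite inE close.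
Qed.

Lemma close_frequency_window_le t s m : (0 < s)%N ->
  (forall i, (i < m)%N -> t <= mdist (iter (s + i) f x) (iter (s + i) f y)) ->
  close_frequency f x y t (s + m) <= s%:R / (s + m)%:R.
Proof.
move=> s_gt0 far; rewrite ler_pM2r ?invr_gt0 ?ltr0n ?addn_gt0 ?s_gt0// ler_nat.
rewrite -[leqRHS](card_ord s) -(card_imset predT (@lshift_inj s m)).
apply/subset_leq_card/fintype.subsetP => j; rewrite inE => j_close.
case: (split_ordP j) j_close => i -> j_close; first exact: imset_f.
by move: j_close; rewrite ltNge far.
Qed.

Lemma window_ratio_le (e : R) : 0 < e -> exists K, forall s m, (0 < s)%N ->
  (K * s <= m)%N -> s%:R / (s + m)%:R <= e.
Proof.
move=> e_gt0; exists (Num.bound e^-1) => s m s_gt0 Ksm.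
rewrite ler_pdivrMr ?ltr0n ?addn_gt0 ?s_gt0// mulrC -ler_pdivrMr//.
apply: (@le_trans _ _ (Num.bound e^-1 * s)%:R).
  by rewrite natrM mulrC ler_wpM2r// ltW// archi_boundP// invr_ge0 ltW.
by rewrite ler_nat (leq_trans Ksm)// leq_addl.
Qed.

(** As [m] is large compared with [s], the window fills almost all of the first [s + m] times, so
    the frequency at its end is nearly 1 or nearly 0. *)
Lemma DC1_pair_windows :
  (forall (t : R) K, 0 < t -> exists s m, [/\ (K < s)%N, (K * s <= m)%N &
    forall i, (i < m)%N -> mdist (iter (s + i) f x) (iter (s + i) f y) < t]) ->
  (exists2 t : R, 0 < t & forall K, exists s m, [/\ (K < s)%N, (K * s <= m)%N &
    forall i, (i < m)%N -> t <= mdist (iter (s + i) f x) (iter (s + i) f y)]) ->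
  DC1_pair f x y.
Proof.
move=> close [t t_gt0 far]; split=> [t' t'_gt0|]; last exists t => //.
  apply: limn_sup_eq1 => [n|e N e_gt0]; first exact: close_frequency_le1.
  have [K KP] := window_ratio_le e_gt0.
  have [s [m [Ks Ksm smP]]] := close t' (maxn N K) t'_gt0.
  have s_gt0 : (0 < s)%N by exact: leq_trans Ks.
  exists (s + m)%N.
    by rewrite (leq_trans (leq_maxl N K))// (leq_trans (ltnW Ks))// leq_addr.
  apply: le_trans (close_frequency_window_ge s_gt0 smP).
  have sm_neq0 : (s + m)%:R != 0 :> R by rewrite pnatr_eq0 addn_eq0 -leqn0 leqNgt s_gt0.
  have -> : m%:R / (s + m)%:R = 1 - s%:R / (s + m)%:R :> R.
    by rewrite -{1}(addKn s m) natrB ?leq_addr// mulrBl divff.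
  by rewrite lerD2l lerN2 KP// (leq_trans _ Ksm)// leq_mul2r leq_maxr orbT.
apply: limn_inf_eq0 => [n|e N e_gt0]; first exact: close_frequency_ge0.
have [K KP] := window_ratio_le e_gt0.
have [s [m [Ks Ksm smP]]] := far (maxn N K).
have s_gt0 : (0 < s)%N by exact: leq_trans Ks.
exists (s + m)%N.
  by rewrite (leq_trans (leq_maxl N K))// (leq_trans (ltnW Ks))// leq_addr.
apply: (le_trans (close_frequency_window_le s_gt0 smP)).
by rewrite KP// (leq_trans _ Ksm)// leq_mul2r leq_maxr orbT.
Qed.

End frequencies.

(** * Labels, Cantor's diagonal argument and choice of indices *)

Lemma recurrent_labels (T : countType) (t0 : T) :
  exists l : nat -> T, forall t N, exists2 k, (N <= k)%N & l k = t.
Proof.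
(* The label is coded by the 2-adic valuation, and each valuation occurs at arbitrarily large
   indices; [t0] stands in for codes that decode to nothing. *)
exists (fun k => odflt t0 (unpickle (logn 2 k))) => t N.
exists (2 ^ pickle t * N.*2.+1)%N.
  apply: (@leq_trans N.*2.+1); first by rewrite -addnn; lia.
  by rewrite leq_pmull// expn_gt0.
rewrite lognM ?expn_gt0// pfactorK// lognE/= dvdn2 /= odd_double addn0.
by rewrite pickleK.
Qed.

Lemma range_uncountable (T : Type) (z : (nat -> bool) -> T) :
  injective z -> ~ countable (range z).
Proof.
move=> z_inj /countable_injP[g g_inj].
have gz_inj xi eta : g (z xi) = g (z eta) -> xi = eta.
  by move=> gE; apply: z_inj; apply: g_inj gE; rewrite inE; eexists.
have /choice[code codeP] : forall n, exists eta, forall xi, g (z xi) = n -> xi = eta.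
  move=> n; have [[eta <-]|no] := pselect (exists eta, g (z eta) = n).
    by exists eta => xi; exact: gz_inj.
  by exists (fun=> true) => xi gz; case: no; exists xi.
(* The diagonal sequence differs from each [code n] at [n]. *)
pose xi n := ~~ code n n.
have /(congr1 (fun h => h (g (z xi)))) := codeP _ xi erefl.
by rewrite /xi; case: (code _ _).
Qed.

(** Take the largest [k <= n] with [P k] and [b k <= n]. Each [k] with [P k] is eventually
    admissible, so this choice tends to infinity. *)
Lemma slow_index (P : pred nat) (b : nat -> nat) :
  (forall N, exists2 k, (N <= k)%N & P k) ->
  exists2 kappa : nat -> nat, kappa n @[n --> \oo] --> \oo &
    \forall n \near \oo, P (kappa n) /\ (b (kappa n) <= n)%N.
Proof.
move=> P_inf; pose A n := [pred k : 'I_n.+1 | P k && (b k <= n)%N].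
have A_near N : exists2 k, (N <= k)%N &
    \forall n \near \oo, exists2 i : 'I_n.+1, i = k :> nat & i \in A n.
  have [k Nk Pk] := P_inf N; exists k => //.
  exists (maxn k (b k)) => // n /=; rewrite geq_max => /andP[kn bn].
  by exists (Ordinal (kn : (k < n.+1)%N)); rewrite // inE Pk.
exists (fun n => \max_(k in A n) k)%N.
  apply/cvgnyPge => N; have [k Nk kA] := A_near N.
  apply: filterS kA => n [i iE iA].
  by rewrite (leq_trans Nk)// -iE (leq_bigmax_cond (F := fun k : 'I_n.+1 => val k)).
have [k _ kA] := A_near 0%N; apply: filterS kA => n [i _ iA].
have [|j jA ->] := @eq_bigmax_cond _ (A n) (fun k => val k).
  by apply/card_gt0P; exists i.
by move: jA; rewrite inE => /andP[].
Qed.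

(** * Transitivity criterion and transfer of limit measures by shadowing *)

Section shadowing.
Context {R : realType} {X : pointedMetricType R} (f : X -> X).
Hypothesis X_compact : compact [set: X].

Lemma transitive_pointsP x :
  (forall y (e : R) N, 0 < e -> exists2 n, (N <= n)%N & mdist y (iter n f x) < e) ->
  transitive_points f x.
Proof.
move=> x_dense; apply/seteqP; split=> // y _ A B [N _ NA].
rewrite -nbhs_ballE => -[e /= e_gt0 yeB].
have [n Nn yn] := x_dense y e N e_gt0.
by exists (iter n f x); split; [exact: NA|apply: yeB; rewrite ballEmdist].
Qed.

(** A time [n] of [x] is assigned a window [k], then a time [n'] inside that window with nearly the
    same means; [z] is read at [s k + n']. Since [k * s k <= n'], the part of the orbit of [z]
    before the window is negligible. *)
Lemma limit_measures_shadowing x z (s L : nat -> nat) (c : nat -> R) (P : pred nat) :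
  (forall N, exists2 k, (N <= k)%N & P k) ->
  (forall k, (k <= s k)%N) ->
  c k @[k --> \oo] --> 0 ->
  (forall k, (k * s k <= L k)%N /\ forall n, (k * s k <= n)%N ->
    exists2 n', (k * s k <= n' <= L k)%N &
    forall (phi : X -> R) (B eta : R), (forall y, `|phi y| <= B) ->
      (forall y y', mdist y y' < k.+1%:R^-1 -> `|phi y - phi y'| <= eta) ->
      `|mean (fun i => phi (iter i f x)) n'.+1 -
        mean (fun i => phi (iter i f x)) n.+1| <= 2 * eta + k.+1%:R^-1 * B) ->
  (forall k i, P k -> (i <= L k)%N ->
    mdist (iter i f x) (iter (s k + i) f z) <= c k) ->
  limit_measures f x `<=` limit_measures f z.
Proof.
move=> P_inf s_ge c0 L_rec shadow.
have [kappa kappa_oo kappaP] := slow_index (fun k => k * s k)%N P_inf.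
have /choice[tau tauP] : forall kn : nat * nat, exists n', (kn.1 * s kn.1 <= kn.2)%N ->
    (kn.1 * s kn.1 <= n' <= L kn.1)%N /\
    forall (phi : X -> R) (B eta : R), (forall y, `|phi y| <= B) ->
      (forall y y', mdist y y' < kn.1.+1%:R^-1 -> `|phi y - phi y'| <= eta) ->
      `|mean (fun i => phi (iter i f x)) n'.+1 -
        mean (fun i => phi (iter i f x)) kn.2.+1| <= 2 * eta + kn.1.+1%:R^-1 * B.
  move=> [k n]; have [kn|_] := leqP (k * s k) n; last by exists 0%N.
  by have [n' n'L n'P] := (L_rec k).2 n kn; exists n'.
apply: (@limit_measures_sub _ _ _ x z (fun n => s (kappa n) + tau (kappa n, n))%N).
  apply/cvgnyPge => N; move/cvgnyPge/(_ N) : kappa_oo; apply: filterS => n Nn.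
  by rewrite (leq_trans Nn)// (leq_trans (s_ge _))// leq_addr.
move=> phi.
have [B phiB] : exists B : R, forall y, `|phi y| <= B.
  have /compact_bounded[B [_ BP]] : compact (range phi).
    by apply: continuous_compact => //; apply: continuous_subspaceT; exact: cts_fun.
  by exists (B + 1) => y; apply: (BP (B + 1)); [rewrite ltrDl|exists y].
have B_ge0 : 0 <= B by exact: le_trans (phiB point).
apply/cvgrPdist_le => e e_gt0.
(* Of the six shares of [e], three pay for replacing [n] by [n'], one for the shadowing and two for
   the delay [s k]. *)
have [d d_gt0 phi_d] : exists2 d : R, 0 < d & forall y y', mdist y y' < d ->
    `|phi y - phi y'| <= e / 6.
  have [||d d_gt0 dP] := compact_unif_continuous X_compact (g := phi) _ (e := e / 6).
  - exact: cts_fun.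
  - by rewrite divr_gt0.
  - by exists d => // y y' /dP/ltW.
have inv0 : (k.+1%:R^-1 : R) @[k --> \oo] --> 0 by exact: cvg_harmonic.
have small : \forall k \near \oo, [/\ c k < d, k.+1%:R^-1 < d &
    k.+1%:R^-1 * B <= e / 6].
  near=> k; split.
  - near: k; move/cvgrPdist_lt: c0 => /(_ d d_gt0); apply: filterS => k.
    by rewrite sub0r normrN; exact: le_lt_trans (ler_norm _).
  - near: k; move/cvgrPdist_lt: inv0 => /(_ d d_gt0); apply: filterS => k.
    by rewrite sub0r normrN; exact: le_lt_trans (ler_norm _).
  - near: k; have e6 : 0 < e / 6 / (B + 1) by rewrite !divr_gt0// ltr_wpDl.
    move/cvgrPdist_le: inv0 => /(_ _ e6); apply: filterS => k.
    rewrite sub0r normrN ger0_norm ?invr_ge0// ler_pdivlMr ?ltr_wpDl//.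
    by apply: le_trans; rewrite ler_pM2l ?invr_gt0// lerDl.
move: (kappa_oo _ small) => kappa_small.
near=> n.
have [Pk kn] : P (kappa n) /\ (kappa n * s (kappa n) <= n)%N by near: n.
have [ck kd kB] : [/\ c (kappa n) < d, (kappa n).+1%:R^-1 < d &
    (kappa n).+1%:R^-1 * B <= e / 6] by near: n.
have [/= /andP[ktau tauL] /(_ phi B (e / 6) phiB)] := tauP (_, _) kn.
move: kn ck kd kB Pk ktau tauL; set k := kappa n; set n' := tau _.
move=> kn ck kd kB Pk ktau tauL near_n; rewrite sub0r normrN distrC.
have := near_n (fun y y' yy' => phi_d y y' (lt_trans yy' kd)).
have ratioB : 2 * B * ((s k)%:R / (s k + n'.+1)%:R) <= 2 * (e / 6).
  rewrite -mulrA ler_pM2l//; apply: le_trans kB; rewrite mulrC ler_wpM2r//.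
  rewrite ler_pdivrMr ?ltr0n ?addnS// mulrC ler_pdivlMr ?ltr0n// -natrM ler_nat.
  by rewrite mulnS -addnS leq_add2l leqW// mulnC.
have := @mean_shift _ (fun i => phi (iter i f z)) (fun i => phi (iter i f x))
  (s k) n'.+1 B (e / 6) isT (fun=> phiB _) (fun=> phiB _).
move=> /(_ _)/wrap[i in'|].
  by apply/phi_d/(le_lt_trans _ ck)/shadow; rewrite // (leq_trans _ tauL).
rewrite addnS in ratioB *; move: ratioB kB.
move: (2 * B * (_ / _)) (_^-1 * B) => a b aE bE; rewrite !ler_norml.
move: (mean _ _) (mean _ _) (mean _ _) => m1 m2 m3; lra.
Unshelve. all: by end_near. Qed.

End shadowing.

Theorem theorem1 (R : realType) (X : pointedMetricType R) (f : X -> X)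
    (hf : dynamical_system f) (hspec : nonuniform_specification f)
    (K : set (probability (borel X) R)) (K_inv : K `<=` invariant_measures f)
    (K_neq0 : K !=set0) (GK_neq0 : over_saturated f K !=set0)
    (U : set X) (U_open : open U) (U_neq0 : U !=set0) :
  exists S : set X,
    [/\ ~ countable S, DC1_scrambled f S &
        S `<=` over_saturated f K `&` U `&` transitive_points f].
Proof.
have [X_compact _ f_cont] := hf; have [M fM] := hspec.
have [x0 x0K] := GK_neq0; have [u Uu] := U_neq0.
have [r r_gt0 rU] : exists2 r : R, 0 < r & forall y, mdist u y <= r -> U y.
  have := open_nbhs_nbhs (conj U_open Uu); rewrite -nbhs_ballE => -[d /= d_gt0 dU].
  exists (d / 2) => [|y uy]; first by rewrite divr_gt0.
  apply: dU; rewrite ballEmdist/= (le_lt_trans uy)//.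
  by rewrite ltr_pdivrMr// ltr_pMr// ltr1n.
have [t t_gt0 /choice[p /choice[q pqP]]] := separated_orbits fM hf.
have inv_gt0 n : 0 < n.+1%:R^-1 :> R by rewrite invr_gt0.
have /choice[net netP] := fun n => finite_net X_compact (inv_gt0 n).
(* Each label occurs infinitely often: [inl (m, i)] requests a visit to the point
   [i] of the net [m], [inr None] a run along the orbit of [x0], and
   [inr (Some j)] a run along an orbit selected by the bit [j]. *)
have [lab labP] := recurrent_labels (inr None : nat * nat + option nat)%type.
(* The length of window [k] depends on its start: it is at least [k] times the start and leaves room
   for the recurrence of the means of [x0]. *)
have /choice[L' L'P] : forall ks : nat * nat, exists N, (ks.1 * ks.2 <= N)%N /\
    forall n, (ks.1 * ks.2 <= n)%N -> exists2 n', (ks.1 * ks.2 <= n' <= N)%N &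
    forall (phi : X -> R) (B eta : R), (forall y, `|phi y| <= B) ->
      (forall y y', mdist y y' < ks.1.+1%:R^-1 -> `|phi y - phi y'| <= eta) ->
      `|mean (fun i => phi (iter i f x0)) n'.+1 -
        mean (fun i => phi (iter i f x0)) n.+1| <= 2 * eta + ks.1.+1%:R^-1 * B.
  move=> [k s]; have [N ? ?] := mean_recurrence (fun i => iter i f x0) (k * s)%N
    X_compact (inv_gt0 k).
  by exists N.
have [s [s0_gt0 sL] glue] :=
  specification_gluing fM (fun k s => L' (k, s)) u X_compact f_cont r_gt0.
pose L k := L' (k, s k).
have L_ge k : (k * s k <= L k)%N by exact: (L'P (k, s k)).1.
have s_gt k : (k < s k)%N.
  elim: k => // k IH; rewrite (leq_ltn_trans IH)// (leq_ltn_trans _ (sL k))//.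
  exact: leq_addr.
pose w (xi : nat -> bool) k := match lab k with
  | inl (m, i) => nth point (net m) i
  | inr None => x0
  | inr (Some j) => if xi j then p (L k) else q (L k)
  end.
have /choice[z zP] : forall xi, exists z, mdist u z <= r /\ forall k i, (i <= L k)%N ->
    mdist (iter i f (w xi k)) (iter (s k + i) f z) <= r / 2 ^+ k.
  by move=> xi; have [z uz zw] := glue (w xi); exists z.
have r0 : (r / 2 ^+ k) @[k --> \oo] --> 0.
  under eq_fun do rewrite -exprVn.
  by apply: cvg_geometric; rewrite ger0_norm// invf_lt1// ltr1n.
have small e N : 0 < e -> exists2 k0, (N <= k0)%N &
    forall k, (k0 <= k)%N -> r / 2 ^+ k < e.
  move/cvgrPdist_lt: r0 => /[apply] -[k0 _ k0P].
  exists (maxn N k0) => [|k]; first exact: leq_maxl.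
  rewrite geq_max => /andP[_ /k0P]/=; rewrite sub0r normrN.
  exact: le_lt_trans (ler_norm _).
(* In windows reading a bit where [xi] and [eta] differ, the followed orbits are at least [t] apart;
   two shadowing errors below [t / 4] leave [t / 2]. *)
have far xi eta : xi <> eta -> exists2 t' : R, 0 < t' & forall N,
    exists s m, [/\ (N < s)%N, (N * s <= m)%N & forall i, (i < m)%N ->
      t' <= mdist (iter (s + i) f (z xi)) (iter (s + i) f (z eta))].
  move=> xi_eta; have [j jP] : exists j, xi j <> eta j.
    by apply/existsNP => same; apply/xi_eta/funext.
  exists (t / 2) => [|N]; first by rewrite divr_gt0.
  have t4_gt0 : 0 < t / 4 by rewrite divr_gt0.
  have [k0 Nk0 k0P] := small _ N t4_gt0.
  have [k k0k labk] := labP (inr (Some j)) k0; have Nk := leq_trans Nk0 k0k.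
  exists (s k), (L k); split=> [||i iL]; first exact: leq_ltn_trans (s_gt k).
    by rewrite (leq_trans _ (L_ge k))// leq_mul2r Nk orbT.
  have := (zP xi).2 k i (ltnW iL); have := (zP eta).2 k i (ltnW iL).
  have := k0P k k0k; have := pqP (L k) i (ltnW iL).
  have wd : mdist (iter i f (w xi k)) (iter i f (w eta k)) =
      mdist (iter i f (p (L k))) (iter i f (q (L k))).
    rewrite /w labk; case: (xi j) (eta j) jP => [] [] // _.
    exact: metric_sym.
  rewrite -wd; move: (iter i f (w xi k)) (iter i f (w eta k)) => a b.
  move: (iter _ _ _) (iter _ _ _) (r / _) => a' b' c tab ct bb' aa'.
  have := metric_triangle a a' b; have := metric_triangle a' b' b.
  rewrite (metric_sym b' b); lra.
have close xi eta (e : R) N : 0 < e -> exists s m, [/\ (N < s)%N, (N * s <= m)%N &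
    forall i, (i < m)%N -> mdist (iter (s + i) f (z xi)) (iter (s + i) f (z eta)) < e].
  move=> e_gt0; have e2_gt0 : 0 < e / 2 by rewrite divr_gt0.
  have [k0 Nk0 k0P] := small _ N e2_gt0.
  have [k k0k labk] := labP (inr None) k0; have Nk := leq_trans Nk0 k0k.
  exists (s k), (L k); split=> [||i iL]; first exact: leq_ltn_trans (s_gt k).
    by rewrite (leq_trans _ (L_ge k))// leq_mul2r Nk orbT.
  have := (zP xi).2 k i (ltnW iL); have := (zP eta).2 k i (ltnW iL).
  rewrite /w labk [e]splitr => z1 z2.
  apply: (le_lt_trans (metric_triangle _ (iter i f x0) _)).
  rewrite (metric_sym _ (iter i f x0)).
  by apply: ltrD; apply: le_lt_trans (k0P k k0k).
have z_inj : injective z.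
  move=> xi eta z_eq; have [//|xi_eta] := pselect (xi = eta).
  (* The value 1 makes the window nonempty, so its first time contradicts [z xi = z eta]. *)
  have [t' t'_gt0 /(_ 1%N)[s' [m [s'_gt m_ge]]]] := far _ _ xi_eta.
  move=> /(_ 0%N); rewrite z_eq mdistxx leNgt t'_gt0 => /(_ _)/negP.
  by case=> //; rewrite (leq_trans _ m_ge)// mul1n (leq_trans _ s'_gt).
exists (range z); split; first exact: range_uncountable.
  move=> _ _ [xi _ <-] [eta _ <-] z_neq; apply: DC1_pair_windows.
    by move=> e N; exact: close.
  by apply: far => xi_eta; apply: z_neq; rewrite xi_eta.
move=> _ [xi _ <-]; split; first split.
- apply: (subset_trans x0K).
  apply: (limit_measures_shadowing X_compact (s := s) (L := L)
    (P := fun k => lab k == inr None) _ _ r0) => [N|k|k|k i /eqP labk iL].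
  + by have [k Nk labk] := labP (inr None) N; exists k; rewrite // labk.
  + exact: ltnW.
  + exact: (L'P (k, s k)).
  + by have := (zP xi).2 k i iL; rewrite /w labk.
- exact/rU/(zP xi).1.
apply: transitive_pointsP => y e N e_gt0; have e2_gt0 : 0 < e / 2 by rewrite divr_gt0.
have [m m_lt] : exists m, m.+1%:R^-1 < e / 2.
  have := @cvg_harmonic R; move=> /cvgrPdist_lt/(_ _ e2_gt0)[m _ /(_ m (leqnn m))].
  by rewrite /= sub0r normrN ger0_norm// => m_lt; exists m.
have [a a_net ya] := netP m y.
have [k0 Nk0 k0P] := small _ N e2_gt0.
have [k k0k labk] := labP (inl (m, index a (net m))) k0.
exists (s k); first by rewrite (leq_trans Nk0)// (leq_trans k0k)// ltnW.
(* Only the start of the window matters: there the orbit is close to the net point [a]. *)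
have := (zP xi).2 k 0%N (leq0n _); rewrite addn0 /w labk /= nth_index// => az.
rewrite [e]splitr (le_lt_trans (metric_triangle _ a _))// ltrD//.
  exact: lt_trans m_lt.
exact: le_lt_trans (k0P k k0k).
Qed.
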